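(* Let $\phi$ be a linear CNF formula. If there exist a number $m$ and a subset of clauses $F \subseteq \phi$ such that $\phi$ is $m$-extensible with respect to $F$, then every tree-like $\mathrm{Res}(\oplus)$ refutation of $\phi$ has size at least $2^{m}$.
   Context: A linear literal is an equation $f = \alpha$, where $f$ is a linear form over $\mathbb{F}_2$ in the variables and $\alpha \in \{0,1\}$. A linear clause is a disjunction of linear literals; a linear CNF formula is a conjunction (set) of linear clauses. A linear clause $D$ is semantically implied by linear clauses $C_1,\dots,C_s$ if every assignment satisfying all $C_i$ satisfies $D$. The proof system $\mathrm{Res}(\oplus)$ has two rules: (Resolution) from $A \lor (f=0)$ and $B \lor (f=1)$ derive $A \lor B$, where $f$ is a linear form over $\mathbb{F}_2$; (Weakening) from a linear clause $C$ derive any linear clause $D$ semantically implied by $C$. A refutation of $\phi$ is a derivation of the empty clause from the clauses of $\phi$ by these rules. It is tree-like if it can be arranged as a binary tree whose root is labeled by the empty clause, whose leaves are labeled by clauses of $\phi$, and each internal node is labeled by the result of applying one of the rules to its children; its size is the number of clauses (nodes) in it. Let $\phi$ be a linear CNF in variables $v$ and $F \subseteq \phi$ a subset of its clauses. A solution $\sigma$ of a linear system $Av=b$ over $\mathbb{F}_2$ is $F$-proper if $\sigma$ satisfies every clause of $F$. The formula $\phi$ is $m$-extensible with respect to $F$ if for every linear system $Av = b$ over $\mathbb{F}_2$ in the variables $v$ with fewer than $m$ equations that has an $F$-proper solution, and for every clause $C \in \phi \setminus F$, there exists an $F$-proper solution of $Av=b$ that satisfies $C$.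
   Formalization: The subset F is additionally assumed satisfiable; otherwise m-extensibility holds vacuously for every m and the claim fails, e.g. for φ = F consisting of the empty clause and m = 1, where a refutation of size 1 exists. *)

(* Defs.v *)
From mathcomp Require Import all_boot all_order all_algebra.

Set Implicit Arguments.
Unset Strict Implicit.
Unset Printing Implicit Defensive.

Import GRing.Theory.
Local Open Scope ring_scope.

(* The pair (f, a) is the literal f = a, with f the row of coefficients of a
   linear form in n variables; an assignment is a column vector. *)
Definition linear_literal (n : nat) := ('rV['F_2]_n * 'F_2)%type.
Definition linear_clause (n : nat) := {set linear_literal n}.
Definition linear_cnf (n : nat) := {set linear_clause n}.

Definition sat_literal n (v : 'cV['F_2]_n) (l : linear_literal n) : bool :=
  (l.1 *m v) 0 0 == l.2.

Definition sat_clause n (v : 'cV['F_2]_n) (C : linear_clause n) : bool :=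
  [exists l in C, sat_literal v l].

Definition sat_cnf n (v : 'cV['F_2]_n) (phi : linear_cnf n) : bool :=
  [forall C in phi, sat_clause v C].

Definition satisfiable n (phi : linear_cnf n) : Prop :=
  exists v : 'cV['F_2]_n, sat_cnf v phi.

Definition semantically_implied n (Cs : {set linear_clause n})
    (D : linear_clause n) : Prop :=
  forall v : 'cV['F_2]_n, sat_cnf v Cs -> sat_clause v D.

(* Tree-like derivations: an inhabitant is the tree itself, so a clause used
   several times is derived (and counted) several times.  In Res_resolution,
   A and B are arbitrary and may themselves contain the resolved literal. *)
Inductive tree_derivation n (phi : linear_cnf n) : linear_clause n -> Type :=
| Res_leaf (C : linear_clause n) of C \in phi : tree_derivation phi C
| Res_resolution (A B : linear_clause n) (f : 'rV['F_2]_n) of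
    tree_derivation phi (A :|: [set (f, 0)]) &
    tree_derivation phi (B :|: [set (f, 1)]) :
    tree_derivation phi (A :|: B)
| Res_weakening (C D : linear_clause n) of
    tree_derivation phi C & semantically_implied [set C] D :
    tree_derivation phi D.

Fixpoint tree_size n (phi : linear_cnf n) (C : linear_clause n)
    (t : tree_derivation phi C) : nat :=
  match t with
  | Res_leaf _ _ => 1%N
  | Res_resolution _ _ _ t0 t1 => (tree_size t0 + tree_size t1).+1
  | Res_weakening _ _ t0 _ => (tree_size t0).+1
  end.

Definition tree_refutation n (phi : linear_cnf n) : Type :=
  tree_derivation phi set0.

Definition proper_solution n (F : linear_cnf n) k (A : 'M['F_2]_(k, n))
    (b : 'cV['F_2]_k) (v : 'cV['F_2]_n) : Prop :=
  A *m v = b /\ sat_cnf v F.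

(* Vacuously true when F is unsatisfiable. *)
Definition extensible n (m : nat) (phi F : linear_cnf n) : Prop :=
  forall (k : nat) (A : 'M['F_2]_(k, n)) (b : 'cV['F_2]_k),
    (k < m)%N ->
    (exists v, proper_solution F A b v) ->
    forall C : linear_clause n, C \in phi :\: F ->
      exists v, proper_solution F A b v /\ sat_clause v C.

(* Main.v *)
(** Walk from the root to a leaf while keeping a linear system that has an
    [F]-proper solution and all of whose [F]-proper solutions falsify the
    current clause.  At a resolution on [f], either [f] is constant on the
    [F]-proper solutions and one premise inherits the system, or both
    [f = 0] and [f = 1] can be added, which costs one equation and forces
    both subtrees to be large.  By extensibility no leaf is reached with fewer
    than [m] equations, so the size is at least [2 ^ (m - k)] once [k]
    equations have been used. *)
Require Import Defs.
From mathcomp Require Import all_boot all_order all_algebra.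

Lemma sat_cnf_set1 n (v : 'cV['F_2]_n) (C : linear_clause n) :
  sat_cnf v [set C] = sat_clause v C.
Proof.
apply/forall_inP/idP => [satC | satC D /set1P-> //].
by apply: satC; rewrite set11.
Qed.

Lemma sat_clauseU n (v : 'cV['F_2]_n) (C D : linear_clause n) :
  sat_clause v (C :|: D) = sat_clause v C || sat_clause v D.
Proof.
apply/exists_inP/orP => [[l /setUP[lC | lD] satl] | [] /exists_inP[l lC satl]].
- by left; apply/exists_inP; exists l.
- by right; apply/exists_inP; exists l.
- by exists l => //; rewrite inE lC.
- by exists l => //; rewrite inE lC orbT.
Qed.

Lemma sat_clause_set1 n (v : 'cV['F_2]_n) (l : linear_literal n) :
  sat_clause v [set l] = sat_literal v l.
Proof.
apply/exists_inP/idP => [[k /set1P-> //] | satl].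
by exists l; rewrite ?set11.
Qed.

Lemma sat_clause_set0 n (v : 'cV['F_2]_n) : sat_clause v set0 = false.
Proof. by apply/exists_inP => -[l]; rewrite inE. Qed.

Lemma sat_literal0N1 n (v : 'cV['F_2]_n) (f : 'rV['F_2]_n) :
  sat_literal v (f, 0%R) = ~~ sat_literal v (f, 1%R).
Proof.
by rewrite /sat_literal /=; case: ((f *m v)%R _ _) => [[|[|//]] ltx2].
Qed.

(** Branching on [f] costs exactly one row in the equation count. *)
Lemma proper_solution_add n (F : linear_cnf n) k (A : 'M['F_2]_(k, n))
    (b : 'cV['F_2]_k) (f : 'rV['F_2]_n) (a : 'F_2) (v : 'cV['F_2]_n) :
  proper_solution F (col_mx f A) (col_mx (a%:M : 'M_1) b)%R v <->
  proper_solution F A b v /\ sat_literal v (f, a).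
Proof.
rewrite /proper_solution /sat_literal mul_col_mx /=; split.
  by case=> /eq_col_mx[-> ->] satF; rewrite mxE.
case=> -[-> satF] /eqP fva; split=> //; congr col_mx.
by rewrite [LHS]mx11_scalar fva.
Qed.

Lemma tree_size_gt0 n (phi : linear_cnf n) C (t : tree_derivation phi C) :
  0 < tree_size t.
Proof. by case: t. Qed.

(* For [m <= k] the truncated difference turns the bound into [1 <= tree_size t]. *)
Lemma tree_size_falsified n (phi : linear_cnf n) m (F : linear_cnf n)
    (phi_ext : extensible m phi F) C (t : tree_derivation phi C) :
  forall k (A : 'M['F_2]_(k, n)) (b : 'cV['F_2]_k),
    (exists v, proper_solution F A b v) ->
    (forall v, proper_solution F A b v -> ~~ sat_clause v C) ->
  2 ^ (m - k) <= tree_size t.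
Proof.
elim: t => {C} [C Cphi | C D f t0 IH0 t1 IH1 | C D t IH CD] k A b solAb falsC;
  (have [lekm | ltkm] := leqP m k;
    first by rewrite (eqP lekm : m - k = 0) expn0 tree_size_gt0).
(* A leaf cannot be falsified: a clause of [F] holds by properness, any other by extensibility, as
   [k < m]. *)
- have [CF | CnF] := boolP (C \in F).
    have [v vAb] := solAb; case/negP: (falsC v vAb).
    by have [_ /forall_inP] := vAb; apply.
  have CphiF : C \in phi :\: F by rewrite inE CnF.
  by have [v [/falsC/negPf->]] := phi_ext k A b ltkm solAb C CphiF.
- have falsP E a v : ~~ sat_clause v E -> ~~ sat_literal v (f, a) ->
      ~~ sat_clause v (E :|: [set (f, a)]).
    by rewrite sat_clauseU sat_clause_set1 negb_or => -> ->.
  have falsCD v : proper_solution F A b v ->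
      ~~ sat_clause v C /\ ~~ sat_clause v D.
    by move=> /falsC; rewrite sat_clauseU => /norP.
  (* A boolean form, so that existence over the finitely many assignments is decidable. *)
  pose hits a v := [&& (A *m v == b)%R, sat_cnf v F & sat_literal v (f, a)].
  have hitsP a v : reflect (proper_solution F A b v /\ sat_literal v (f, a))
                           (hits a v).
    by apply: (iffP and3P) => [[/eqP Avb satF lit] | [[/eqP Avb satF] lit]].
  rewrite /=.
  have [/existsP[v0 /hitsP v0P] | /existsPn no0] := boolP [exists v, hits 0%R v];
    last first.
    (* Every proper solution has [f = 1] and falsifies the left premise, so that subtree alone gives
       the bound. *)
    apply/leqW/(leq_trans _ (leq_addr _ _))/(IH0 _ _ _ solAb) => v vAb.
    apply: falsP; first by case: (falsCD v vAb).
    by apply: contra (no0 v) => lit; apply/hitsP.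
  have [/existsP[v1 /hitsP v1P] | /existsPn no1] := boolP [exists v, hits 1%R v];
    last first.
    apply/leqW/(leq_trans _ (leq_addl _ _))/(IH1 _ _ _ solAb) => v vAb.
    apply: falsP; first by case: (falsCD v vAb).
    by apply: contra (no1 v) => lit; apply/hitsP.
  (* As [k < m], the bound splits into two copies of [2 ^ (m - k.+1)], one per subtree. *)
  rewrite -subnSK // expnS mul2n -addnn leqW // leq_add //.
    (* Falsifying the premise with [f = 0] takes the opposite equation [f = 1], attained at [v1]. *)
    apply: (IH0 _ (col_mx f A) (col_mx 1%:M b)%R) => [|v].
      by exists v1; apply/proper_solution_add.
    case/proper_solution_add=> vAb lit1.
    by apply: falsP; [case: (falsCD v vAb) | rewrite sat_literal0N1 lit1].
  apply: (IH1 _ (col_mx f A) (col_mx 0%:M b)%R) => [|v].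
    by exists v0; apply/proper_solution_add.
  case/proper_solution_add=> vAb lit0.
  by apply: falsP; [case: (falsCD v vAb) | rewrite -sat_literal0N1].
- rewrite /= leqW //; apply: IH => [|v vAb]; first exact: solAb.
  apply: contra (falsC v vAb) => satC.
  by apply: CD; rewrite sat_cnf_set1.
Qed.

Theorem theorem3p1 (n : nat) (phi : linear_cnf n) (m : nat) (F : linear_cnf n)
    (F_sub_phi : F \subset phi)
    (F_sat : satisfiable F)
    (phi_ext : extensible m phi F)
    (pi : tree_refutation phi) :
  2 ^ m <= tree_size pi.
Proof.
rewrite -[m]subn0.
(* The walk starts with no equations, where proper solutions are the models of [F]. *)
pose A0 := (0 : 'M['F_2]_(0, n))%R.
apply: (@tree_size_falsified _ _ _ _ phi_ext _ pi 0 A0 0%R) => [|v _].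
  by have [v satF] := F_sat; exists v; split=> //; rewrite mul0mx.
by rewrite sat_clause_set0.
Qed.
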